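(* Let $\mathcal{L}\subseteq \mathrm{Lin}$ be nonempty and downward $\preceq$-closed. Then the following are equivalent: (i) $\mathcal{L}$ is ccs; (ii) $\trianglelefteq^{\mathcal{L}}$ is transitive (as a relation on all linear orders); (iii) $\trianglelefteq^{\mathcal{L}}_{\mathrm{LO}}$ is transitive.
   Context: Linear orders are reflexive and nonempty. $L\preceq L'$ means there is an embedding $f:L\to L'$, i.e. $x\le_L y\iff f(x)\le_{L'}f(y)$. $\mathrm{LO}\subseteq 2^{\mathbb{N}\times\mathbb{N}}$ is the set of (codes for) linear orders with domain $\mathbb{N}$; $\mathrm{Fin}$ is the set of (codes for) nonempty linear orders on finite subsets of $\mathbb{N}$; $\mathrm{Lin}=\mathrm{Fin}\cup\mathrm{LO}$. A class $\mathcal{L}\subseteq\mathrm{Lin}$ is downward $\preceq$-closed if $K\in\mathrm{Lin}$ and $K\preceq L\in\mathcal{L}$ imply $K\in\mathcal{L}$; in particular $\mathcal{L}$ is isomorphism-invariant, and membership of a linear order in $\mathcal{L}$ is meant up to isomorphism. A subset $I$ of a linear order $L$ is convex if $x\le_L y\le_L z$ and $x,z\in I$ imply $y\in I$. For $A,B\subseteq L$ write $A\le_L B$ (resp. $A<_L B$) if $a\le_L b$ (resp. $a<_L b$) for all $a\in A$, $b\in B$. A $K$-convex partition of $L$ is a partition $(L_k)_{k\in K}$ of $L$ (into nonempty sets) such that $k<_K k'\iff L_k<_L L_{k'}$. The relation $L\trianglelefteq^{\mathcal{L}}L'$ holds iff there are $K\in\mathcal{L}$, a $K$-convex partition $(L_k)_{k\in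 K}$ of $L$, and an embedding $f$ of $L$ into $L'$ such that $f(L_k)$ is a convex subset of $L'$ for every $k\in K$. $\trianglelefteq^{\mathcal{L}}_{\mathrm{LO}}$ is the restriction of $\trianglelefteq^{\mathcal{L}}$ to $\mathrm{LO}$. $\mathcal{L}$ is ccs (closed under convex sums) if for all $K,K'\in\mathcal{L}$ and every family $(K'_k)_{k\in K}$ of nonempty convex subsets of $K'$ such that $k_0<_K k_1\Rightarrow K'_{k_0}\le_{K'}K'_{k_1}$ for all $k_0,k_1\in K$, we have $\sum_{k\in K}K'_k\in\mathcal{L}$. Here $\sum_{k\in K}K'_k$ is the set $\{(x,k): k\in K, x\in K'_k\}$ ordered antilexicographically (so it is the sum of disjoint copies of the $K'_k$). *)

(* Defs.v *)
From HB Require Import structures.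
From mathcomp Require Import all_boot all_order.
From mathcomp Require Import boolp classical_sets functions cardinality.
From Corelib Require Export RelationClasses.

Set Implicit Arguments.
Unset Strict Implicit.
Unset Printing Implicit Defensive.

Import Order.TTheory.
Local Open Scope classical_set_scope.
Local Open Scope order_scope.

(* Linear orders of arbitrary cardinality. With the classical axioms of boolp,
   every type is a choiceType and every Prop-valued relation is the truth of a
   boolean one, so [orderType] covers all linear orders. *)
Record linOrder := LinOrder {
  lin_disp : Order.disp_t;
  lin_sort :> orderType lin_disp;
  lin_inhabited : inhabited lin_sort
}.

Definition embeds d d' (L : orderType d) (L' : orderType d') : Prop :=
  exists f : L -> L', {mono f : x y / x <= y}.

Definition order_isomorphic d d' (L : orderType d) (L' : orderType d') : Prop :=
  exists2 f : L -> L', bijective f & {mono f : x y / x <= y}.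

Definition order_convex d (L : orderType d) (I : set L) : Prop :=
  forall x y z, I x -> I z -> x <= y -> y <= z -> I y.

Definition set_le d (L : orderType d) (A B : set L) : Prop :=
  forall a b, A a -> B b -> a <= b.

Definition set_lt d (L : orderType d) (A B : set L) : Prop :=
  forall a b, A a -> B b -> a < b.

(* A point of 2^(N x N) coding a linear order on the subset
   [set n | r n n] of N; for each n outside the domain, r is false on every
   pair with coordinate n. *)
Record linCode := LinCode {
  code_rel :> rel nat;
  code_field : forall m n, code_rel m n -> code_rel m m && code_rel n n;
  code_anti : antisymmetric code_rel;
  code_trans : transitive code_rel;
  code_total : {in [pred n | code_rel n n] &, total code_rel}
}.

Definition code_dom (r : linCode) : set nat := [set n | r n n].

Definition Fin : set linCode :=
  [set r | finite_set (code_dom r) /\ code_dom r !=set0].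

Definition LO : set linCode := [set r | code_dom r = setT].

Definition Lin : set linCode := Fin `|` LO.

Definition code_sort (r : linCode) : Type := {n : nat | r n n}.

HB.instance Definition _ (r : linCode) := Choice.on (code_sort r).

Section CodeOrder.
Variable r : linCode.

Let le (x y : code_sort r) := r (val x) (val y).

Fact code_le_refl : reflexive le. Proof. by move=> x; exact: valP x. Qed.

Fact code_le_anti : antisymmetric le.
Proof. by move=> x y /code_anti /val_inj. Qed.

Fact code_le_trans : transitive le.
Proof. by move=> y x z; exact: code_trans. Qed.

Fact code_le_total : total le.
Proof. by move=> x y; apply: code_total; exact: valP. Qed.

Fact code_display : Order.disp_t. Proof. exact: Order.Disp tt tt. Qed.

HB.instance Definition _ := Order.Le_isPOrder.Build code_display (code_sort r)
  code_le_refl code_le_anti code_le_trans.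
HB.instance Definition _ :=
  Order.POrder_isTotal.Build code_display (code_sort r) code_le_total.
End CodeOrder.

Coercion code_order (r : linCode) : orderType code_display := code_sort r.

(* Membership in a class of codes is understood up to isomorphism. *)
Definition mem_class (C : set linCode) d (L : orderType d) : Prop :=
  exists2 r : linCode, C r & order_isomorphic r L.

Definition downward_closed (C : set linCode) : Prop :=
  forall K L : linCode, Lin K -> C L -> embeds K L -> C K.

Definition convex_partition d d' (K : orderType d) (L : orderType d')
    (P : K -> set L) : Prop :=
  partition setT P setT /\ forall k k', k < k' <-> set_lt (P k) (P k').

Definition conv_embeds (C : set linCode) d d'
    (L : orderType d) (L' : orderType d') : Prop :=
  exists (K : linCode) (P : K -> set L) (f : L -> L'),
    [/\ C K, convex_partition P, {mono f : x y / x <= y} &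
        forall k, order_convex (f @` P k)].

Definition conv_embeds_all (C : set linCode) (L L' : linOrder) : Prop :=
  conv_embeds C L L'.

Definition conv_embeds_LO (C : set linCode) (L L' : LO) : Prop :=
  conv_embeds C (val L : linCode) (val L' : linCode).

Definition subset_order d (L : orderType d) (A : set L) : Type :=
  {x : L | x \in A}.

HB.instance Definition _ d (L : orderType d) (A : set L) :=
  SubChoice.on (subset_order A).
HB.instance Definition _ d (L : orderType d) (A : set L) :=
  [SubChoice_isSubOrder of subset_order A by <: with d].

(* The library order on a sigma type compares tags first: on pairs (x, k)
   stored as a tag k with x above it, it is the antilexicographic order. *)
Definition convex_sum d d' (K : orderType d) (K' : orderType d')
    (F : K -> set K') : orderType d' := {k : K & subset_order (F k)}.

Definition ccs (C : set linCode) : Prop :=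
  forall (K K' : linCode) (F : K -> set K'), C K -> C K' ->
    (forall k, F k !=set0) -> (forall k, order_convex (F k)) ->
    (forall k0 k1, k0 < k1 -> set_le (F k0) (F k1)) ->
    mem_class C (convex_sum F).

(* Main.v *)
Require Import Defs.
From HB Require Import structures.
From mathcomp Require Import all_boot all_order ssralg ssrnum rat.
From mathcomp Require Import boolp classical_sets functions cardinality.
From mathcomp Require Import lra.

Set Implicit Arguments.
Unset Strict Implicit.
Unset Printing Implicit Defensive.

Import Order.TTheory GRing.Theory Num.Theory.
Local Open Scope classical_set_scope.
Local Open Scope order_scope.

(** Write [L <| L'] for the relation attached to a class [C]. A convex partition
    of [L] indexed by [K] is a nondecreasing surjection from [L] onto [K], the
    pieces being its fibres ([conv_embedsP]), so [L <| L'] is witnessed by such a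
    map [p : L -> K] with [K] in [C] and an embedding [f] of [L] into [L'] that
    sends each fibre of [p] to a convex set.

    Closure under convex sums implies transitivity. Given witnesses [(p, f)] of
    [L <| L'] and [(p', g)] of [L' <| L''], the map [x |-> (p x, p' (f x))] and
    the embedding [g \o f] witness [L <| L'']: the order of pieces is the convex
    sum over [k] of the sets [p' (f (p^-1 k))], which are convex because [p'] is
    onto and [f] maps fibres of [p] to convex sets
    ([ccs_conv_embeds_trans]). Transitivity on all linear orders contains
    transitivity on the codes with domain all of the natural numbers.

    Conversely, let [S] be the convex sum over [k] in [K] of convex subsets of
    [K']. Both coordinates of [S], in [K] and in [K'], are nondecreasing, and
    together they are injective. Replace each point of [S] by a copy of
    [omega], and let [L''] have, in addition, a copy of [eta] (the order of the
    rationals) after every copy of [omega], while the intermediate order [L']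
    has it only after those points of [S] whose [K']-coordinate occurs again
    later in [S]. With inclusions as embeddings, [L <| L'] holds with the
    fibres of the [K]-coordinate as pieces ([conv_embeds_omegas]), and
    [L' <| L''] with the fibres of the [K']-coordinate
    ([conv_embeds_partial_blocks]). All three orders are countably infinite, so
    transitivity on codes yields [L <| L'']. But a convex subset of [L] meeting
    two copies of [omega] has no embedding into [L''] with convex image
    ([omega_piece]): the successors of a point of the lower copy are sent onto a
    final part of some copy of [omega] in [L''], the image then has to meet
    the copy of [eta] that follows, and a point of [eta] has no immediate
    successor, whereas every point of the subset but possibly the last has one.
    So the pieces of any witness of [L <| L''] lie inside single copies of
    [omega], whence [S] embeds into the index order of the pieces and belongs to
    [C] ([mem_class_sum]). *)

(** * Isomorphisms and codes *)

Lemma order_isomorphic_sym d d' (L : orderType d) (L' : orderType d') :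
  order_isomorphic L L' -> order_isomorphic L' L.
Proof.
move=> [f [g fK gK] f_mono]; exists g; first by exists f.
by move=> x y; rewrite -[in RHS](gK x) -[in RHS](gK y) f_mono.
Qed.

Section CodeOfInjection.
Variables (d : Order.disp_t) (T : orderType d) (i : T -> nat).
Hypothesis i_inj : injective i.

(** The order of [T] carried to the range of [i]; [false] outside that range. *)
Definition transported_rel : rel nat :=
  fun m n => `[< exists x y : T, [/\ i x = m, i y = n & x <= y] >].

Lemma transported_relE (x y : T) : transported_rel (i x) (i y) = (x <= y).
Proof.
apply/asboolP/idP => [[x' [y' [/i_inj -> /i_inj ->]]]//|le_xy].
by exists x, y.
Qed.

Lemma transported_rel_dom m n :
  transported_rel m n -> exists x y : T, i x = m /\ i y = n.
Proof. by move=> /asboolP[x [y [ix iy _]]]; exists x, y. Qed.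

Fact transported_field m n : transported_rel m n ->
  transported_rel m m && transported_rel n n.
Proof.
by move=> /transported_rel_dom[x [y [<- <-]]]; rewrite !transported_relE !lexx.
Qed.

Fact transported_anti : antisymmetric transported_rel.
Proof.
move=> m n /andP[/[dup] /transported_rel_dom[x [y [<- <-]]]].
by rewrite !transported_relE => xy yx; congr i; apply/le_anti/andP.
Qed.

Fact transported_trans : transitive transported_rel.
Proof.
move=> n m k /[dup] /transported_rel_dom[x [y [<- <-]]] xy.
move=> /[dup] /transported_rel_dom[_ [z [_ <-]]].
by move: xy; rewrite !transported_relE; exact: le_trans.
Qed.

Fact transported_total :
  {in [pred n | transported_rel n n] &, total transported_rel}.
Proof.
move=> m n m_dom n_dom.
have [x [_ [<- _]]] := transported_rel_dom (m_dom : transported_rel m m).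
have [y [_ [<- _]]] := transported_rel_dom (n_dom : transported_rel n n).
by rewrite !transported_relE le_total.
Qed.

(** The image of the order of [T] under an injection into the natural numbers,
    as a code with domain the range of that injection. *)
Definition transported_code : linCode :=
  LinCode transported_field transported_anti transported_trans
    transported_total.

Lemma transported_code_dom : code_dom transported_code = range i.
Proof.
apply/seteqP; split=> n /=.
  by move=> /transported_rel_dom[x [_ [<- _]]]; exists x.
by move=> [x _ <-]; rewrite /code_dom /= transported_relE.
Qed.

Lemma transported_code_iso : order_isomorphic transported_code T.
Proof.
apply: order_isomorphic_sym.
have in_dom x : transported_code (i x) (i x).
  by rewrite /= transported_relE.
exists (fun x => exist _ (i x) (in_dom x) : transported_code).
  rewrite -setTT_bijective; split=> //.
    by move=> x y _ _ [/i_inj].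
  move=> [n r_nn] _; have [x [_ [ix _]]] := transported_rel_dom r_nn.
  by exists x => //; apply: val_inj.
by move=> x y; exact: transported_relE.
Qed.
End CodeOfInjection.

(** The range of [j] need not be all of the natural numbers, so the code is
    built from a bijection obtained by cardinality. *)
Lemma infinite_code d (T : orderType d) (j : T -> nat) :
  injective j -> infinite_set [set: T] ->
  exists2 r : linCode, LO r & order_isomorphic r T.
Proof.
move=> j_inj T_inf.
have /card_set_bijP[f] : ([set: T] #= [set: nat])%card.
  apply: eq_card_nat T_inf; apply/countable_injP.
  by exists j => x y _ _ /j_inj.
move=> [_ f_inj f_surj].
have {}f_inj : injective f by move=> x y; apply: f_inj; rewrite in_setT.
exists (transported_code f_inj); last exact: transported_code_iso.
by rewrite /LO /= transported_code_dom; apply/seteqP; split.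
Qed.

Lemma countable_code d (T : orderType d) (j : T -> nat) :
  injective j -> inhabited T ->
  exists2 r : linCode, Lin r & order_isomorphic r T.
Proof.
move=> j_inj [x0]; have [T_fin|T_inf] := pselect (finite_set [set: T]).
  exists (transported_code j_inj); last exact: transported_code_iso.
  left; rewrite /Fin /= transported_code_dom; split; first exact: finite_image.
  by exists (j x0), x0.
by have [r r_LO rT] := infinite_code j_inj T_inf; exists r => //; right.
Qed.

Lemma infinite_inj (T : Type) (f : nat -> T) :
  injective f -> infinite_set [set: T].
Proof.
move=> f_inj T_fin; apply: infinite_nat; rewrite -(preimage_setT f).
by apply: finite_preimage T_fin => x y _ _; exact: f_inj.
Qed.

Lemma code_sort_inhabited (r : linCode) : Lin r -> inhabited r.
Proof.
have code_inh n : code_dom r n -> inhabited r.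
  by move=> rn; exists; exact: exist _ n rn.
case=> [[_ [n rn]]|r_full]; first exact: code_inh rn.
by apply: (code_inh 0%N); rewrite r_full.
Qed.

(** * Classes of codes and convex embeddings *)

Lemma mem_class_self (C : set linCode) (r : linCode) : C r -> mem_class C r.
Proof. by move=> Cr; exists r => //; exists id => //; exists id. Qed.

Lemma mem_class_embeds (C : set linCode) d (T : orderType d) (K : linCode) :
  downward_closed C -> C K -> inhabited T -> embeds T K -> mem_class C T.
Proof.
move=> C_down CK T_inh [f f_mono].
have j_inj : injective (fun x => val (f x)).
  by move=> x y /val_inj /(inc_inj f_mono).
have [r r_Lin rT] := countable_code j_inj T_inh; exists r => //.
apply: C_down CK _ => //; have [g _ g_mono] := rT.
by exists (f \o g) => x y /=; rewrite f_mono g_mono.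
Qed.

(** A convex partition of [L] indexed by [K] is the same thing as a
    nondecreasing surjection of [L] onto [K], the pieces being its fibres. *)
Lemma conv_embedsP (C : set linCode) d d' (L : orderType d) (L' : orderType d') :
  conv_embeds C L L' <->
  exists (K : linCode) (p : L -> K) (f : L -> L'),
    [/\ C K, {homo p : x y / x <= y}, (forall k, exists x, p x = k),
        {mono f : x y / x <= y} &
        forall k, order_convex (f @` [set x | p x = k])].
Proof.
split=> [[K [P [f [CK [[P_cover P_triv P_neq0] P_lt] f_mono f_conv]]]]|].
  have P_ex x : exists k, P k x.
    by have : [set: L] x by []; rewrite -P_cover => -[k _ Pkx]; exists k.
  have [p pP] := choice P_ex.
  have P_fibre k : P k = [set x | p x = k].
    apply/seteqP; split=> x /= => [Pkx|<-//].
    by apply: P_triv => //; exists x.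
  exists K, p, f; split=> //.
  - move=> x y le_xy; rewrite leNgt; apply/negP => /P_lt.
    by move/(_ y x (pP y) (pP x)); rewrite ltNge le_xy.
  - by move=> k; have [x] := P_neq0 k I; rewrite P_fibre; exists x.
  - by move=> k; rewrite -P_fibre.
move=> [K [p [f [CK p_homo p_surj f_mono f_conv]]]].
exists K, (fun k => [set x | p x = k]), f; split=> //; split.
  split=> [|k k' _ _ [x [/= <- <-]]//|k _].
    by apply/seteqP; split=> // x _; exists (p x).
  by have [x px] := p_surj k; exists x.
move=> k k'; split=> [lt_kk' x y /= px py|lt_P].
  by rewrite ltNge; apply: contraL lt_kk' => /p_homo; rewrite px py leNgt.
have [[x px] [y py]] := (p_surj k, p_surj k').
have lt_xy := lt_P _ _ px py.
rewrite lt_neqAle -px -py p_homo ?andbT ?ltW//.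
apply/eqP => pxy; have := lt_P x x px (etrans pxy py).
by rewrite ltxx.
Qed.

(** Here the order of pieces [T] need not be a code, and [p] need not be
    surjective: the range of [p] embeds into a member of [C], so it is again in
    [C] up to isomorphism. *)
Lemma conv_embedsI (C : set linCode) d0 d d' (T : orderType d0)
    (L : orderType d) (L' : orderType d') (p : L -> T) (f : L -> L') :
  downward_closed C -> mem_class C T -> inhabited L ->
  {homo p : x y / x <= y} -> {mono f : x y / x <= y} ->
  (forall k, order_convex (f @` [set x | p x = k])) -> conv_embeds C L L'.
Proof.
move=> C_down [r Cr /order_isomorphic_sym[g g_bij g_mono]] [x0] p_homo f_mono.
move=> f_conv.
have p_range x : p x \in range p by rewrite inE; exists x.
pose q x : subset_order (range p) := exist _ (p x) (p_range x).
have [K CK] : mem_class C (subset_order (range p)).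
  apply: mem_class_embeds Cr _ _ => //; first by exists; exact: q x0.
  by exists (fun x => g (val x)) => x y; rewrite g_mono.
move=> /order_isomorphic_sym[h h_bij h_mono].
apply/conv_embedsP; exists K, (h \o q), f; split=> //.
- by move=> x y le_xy; rewrite /= h_mono; exact: p_homo.
- move=> k; have [h' h'K hh'] := h_bij.
  have /set_mem[x _ px] := valP (h' k).
  by exists x; rewrite /= -[RHS]hh'; congr h; apply: val_inj.
move=> k x y z /= [u /= pu <-] [v /= pv <-] fx fy.
have [] := f_conv (p u) (f u) y (f v) => //; first by exists u.
  have /(inc_inj h_mono)/(congr1 val) := etrans pv (esym pu).
  by exists v.
move=> w /= pw fwy; exists w => //=; rewrite -pu; congr h.
exact: val_inj.
Qed.

Lemma conv_embeds_iso (C : set linCode) d1 d2 d3 d4 (L1 : orderType d1)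
    (L : orderType d2) (L' : orderType d3) (L1' : orderType d4) :
  order_isomorphic L1 L -> order_isomorphic L' L1' ->
  conv_embeds C L L' -> conv_embeds C L1 L1'.
Proof.
move=> [g g_bij g_mono] [h h_bij h_mono] /conv_embedsP[K [p [f]]].
move=> [CK p_homo p_surj f_mono f_conv]; apply/conv_embedsP.
have [g' gK g'K] := g_bij; have [h' hK h'K] := h_bij.
exists K, (p \o g), (h \o f \o g); split=> //.
- by move=> x y le_xy; apply: p_homo; rewrite g_mono.
- by move=> k; have [x px] := p_surj k; exists (g' x); rewrite /= g'K.
- by move=> x y /=; rewrite h_mono f_mono g_mono.
move=> k x y z [u /= pu <-] [v /= pv <-]; rewrite -[y]h'K !h_mono => fx fy.
have [] := f_conv k (f (g u)) (h' y) (f (g v)) => //.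
by move=> w /= pw fw; exists (g' w); rewrite /= g'K ?fw.
Qed.

(** * Convex sums and closure under them *)

Section ConvexSum.
Variables (d d' : Order.disp_t) (K : orderType d) (K' : orderType d').
Variable F : K -> set K'.
Implicit Types x y : convex_sum F.

(** The coordinate in [K'] of a point of the sum; its coordinate in [K] is
    [tag x]. *)
Definition sum_val x : K' := val (tagged x).

Lemma sum_valP x : F (tag x) (sum_val x).
Proof. by have /set_mem := valP (tagged x). Qed.

Lemma convex_sum_point k (k' : K') :
  F k k' -> exists2 x, tag x = k & sum_val x = k'.
Proof.
move=> Fkk'; have k'_in : k' \in F k by rewrite inE.
by exists (Tagged (fun k => subset_order (F k))
  (exist _ k' k'_in : subset_order (F k))).
Qed.

Lemma convex_sum_inj x y : tag x = tag y -> sum_val x = sum_val y -> x = y.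
Proof.
case: x y => [k x] [k1 y]; rewrite /sum_val /= => kk1; case: _ / kk1 y => y.
by move/val_inj => ->.
Qed.

Lemma tag_homo x y : x <= y -> tag x <= tag y.
Proof. by rewrite leEsig => /andP[]. Qed.

Hypothesis F_le : forall k0 k1, k0 < k1 -> set_le (F k0) (F k1).

Lemma sum_val_homo x y : x <= y -> sum_val x <= sum_val y.
Proof.
rewrite le_eqVlt => /predU1P[->//|]; case: (ltgtP (tag x) (tag y)).
- by move=> /F_le lt_F _; apply: lt_F; exact: sum_valP.
- by move=> lt_yx /ltW/tag_homo; rewrite leNgt lt_yx.
case: x y => [k x] [k1 y] /= kk1; case: _ / kk1 y => y.
by rewrite ltEsig /= lexx /= tagged_asE => /ltW.
Qed.
End ConvexSum.

Lemma ccs_conv_embeds_trans (C : set linCode) d d' d'' (L : orderType d)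
    (L' : orderType d') (L'' : orderType d'') :
  downward_closed C -> ccs C -> inhabited L ->
  conv_embeds C L L' -> conv_embeds C L' L'' -> conv_embeds C L L''.
Proof.
move=> C_down C_ccs L_inh /conv_embedsP[K [p [f]]].
move=> [CK p_homo p_surj f_mono f_conv] /conv_embedsP[K' [p' [g]]].
move=> [CK' p'_homo p'_surj g_mono g_conv].
(* The indices of the pieces of L' that meet the image of the piece of L with
   index k. *)
pose F (k : K) : set K' := (p' \o f) @` [set x | p x = k].
have F_neq0 k : F k !=set0.
  by have [x px] := p_surj k; exists (p' (f x)), x.
have F_conv k : order_convex (F k).
  move=> a b c [x /= px <-] [z /= pz <-] le_xb le_bz.
  have [y p'y] := p'_surj b.
  have [<-|xb] := eqVneq (p' (f x)) b; first by exists x.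
  have [<-|zb] := eqVneq (p' (f z)) b; first by exists z.
  have [||||w pw fwy] := f_conv k (f x) y (f z).
  - by exists x.
  - by exists z.
  - by rewrite leNgt; apply: contra xb => /ltW/p'_homo; rewrite p'y eq_le le_xb.
  - rewrite leNgt; apply: contra zb => /ltW/p'_homo.
    by rewrite p'y [in X in _ -> X]eq_le le_bz andbT.
  by exists w => //; rewrite /= fwy.
have F_le k0 k1 : k0 < k1 -> set_le (F k0) (F k1).
  move=> lt_k _ _ [x /= px <-] [y /= py <-]; apply: p'_homo.
  rewrite f_mono leNgt; apply: contraL lt_k => /ltW/p_homo.
  by rewrite px py leNgt.
have in_F x : p' (f x) \in F (p x) by rewrite inE; exists x.
(* The refined partition of L, indexed by the convex sum of the F k. *)
pose q x : convex_sum F := Tagged (fun k => subset_order (F k))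
  (exist _ (p' (f x)) (in_F x) : subset_order (F (p x))).
apply: (@conv_embedsI C _ _ _ (convex_sum F) _ _ q (g \o f)) => //.
- exact: C_ccs.
- move=> x y le_xy; rewrite leNgt; apply/negP => lt_q.
  have pxy : p x = p y.
    by apply/le_anti; rewrite p_homo //=; exact: (tag_homo (ltW lt_q)).
  have p'xy : p' (f x) = p' (f y).
    apply/le_anti; rewrite p'_homo ?f_mono //=.
    exact: (sum_val_homo F_le (ltW lt_q)).
  by move: lt_q; rewrite (@convex_sum_inj _ _ _ _ _ (q x) (q y)) ?ltxx.
- by move=> x y /=; rewrite g_mono f_mono.
move=> s _ y _ [x <- <-] [z qzx <-] /= gxy gyz.
have pzx : tag (q z) = tag (q x) by rewrite (qzx : q z = q x).
have p'zx : sum_val (q z) = sum_val (q x) by rewrite (qzx : q z = q x).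
have [||||y1 /= p'y1 gy1] := g_conv (p' (f x)) (g (f x)) y (g (f z)).
- by exists (f x).
- by exists (f z).
- by [].
- by [].
move: gxy gyz; rewrite -gy1 !g_mono => fxy fyz.
have [||||y2 /= py2 fy2] := f_conv (p x) (f x) y1 (f z).
- by exists x.
- by exists z.
- by [].
- by [].
exists y2; rewrite /= ?fy2 //.
by apply: convex_sum_inj => //; rewrite /sum_val /= fy2.
Qed.

(** * Blocks of type omega + eta *)

(** A copy of the natural numbers followed by a copy of the rationals. *)
Definition omega_eta : Type := (nat + rat)%type.

HB.instance Definition _ := Countable.on omega_eta.

(** All natural numbers come before all rationals. *)
Definition omega_eta_le (x y : omega_eta) : bool :=
  match x, y with
  | inl m, inl n => (m <= n)%O
  | inl _, inr _ => true
  | inr _, inl _ => false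
  | inr p, inr q => (p <= q)%O
  end.

Fact omega_eta_le_refl : reflexive omega_eta_le.
Proof. by case=> x /=. Qed.

Fact omega_eta_le_anti : antisymmetric omega_eta_le.
Proof. by move=> [x|x] [y|y] //= /le_anti ->. Qed.

Fact omega_eta_le_trans : transitive omega_eta_le.
Proof. by move=> [y|y] [x|x] [z|z] //=; exact: le_trans. Qed.

Fact omega_eta_le_total : total omega_eta_le.
Proof. by move=> [x|x] [y|y] //=; exact: le_total. Qed.

Fact omega_eta_display : Order.disp_t. Proof. exact: Order.Disp tt tt. Qed.

HB.instance Definition _ := Order.Le_isPOrder.Build omega_eta_display omega_eta
  omega_eta_le_refl omega_eta_le_anti omega_eta_le_trans.
HB.instance Definition _ :=
  Order.POrder_isTotal.Build omega_eta_display omega_eta omega_eta_le_total.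

Definition in_omega (w : omega_eta) : bool := if w is inl _ then true else false.

Lemma omega_lt (m n : nat) : ((inl m : omega_eta) < inl n) = (m < n)%N.
Proof. by rewrite ltNge ltnNge. Qed.

Lemma omega_lt_eta m q : (inl m : omega_eta) < inr q.
Proof. by rewrite ltNge. Qed.

Lemma eta_lt (p q : rat) : ((inr p : omega_eta) < inr q) = (p < q).
Proof. by rewrite !ltNge. Qed.

Section Blocks.
Variables (d : Order.disp_t) (S : orderType d).

(** The product of [omega + eta] and [S]: each point of [S] is replaced by a
    copy of [omega + eta]. *)
Definition blocks := (S *l omega_eta)%type.
Implicit Types x y z : blocks.

Lemma fst_lt x y : x.1 < y.1 -> x < y.
Proof. by move=> lt_xy; rewrite ltEprodlexi ltW //= leNgt lt_xy. Qed.

Lemma same_block_lt s w w' : ((s, w) : blocks) < (s, w') = (w < w').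
Proof. by rewrite ltEprodlexi /= lexx. Qed.

Lemma block_homo x y : x <= y -> x.1 <= y.1.
Proof. by rewrite leEprodlexi => /andP[]. Qed.

Lemma in_omega_le x y : x <= y -> x.1 = y.1 -> in_omega y.2 -> in_omega x.2.
Proof.
case: x y => [s w] [t [n|//]] /[swap] /= ->.
by rewrite leNgt same_block_lt; case: w => // q; rewrite omega_lt_eta.
Qed.

(** [y] is the immediate successor of [x]. *)
Definition is_succ x y := x < y /\ forall z, x < z -> y <= z.

(** A point with an immediate successor lies in a copy of [omega], and its
    successor is the next point of that copy. *)
Lemma succ_in_omega x y : is_succ x y ->
  exists2 n, x = (x.1, inl n) & y = (x.1, inl n.+1).
Proof.
case: x y => s v [t w] [lt_xy y_min].
have st : s = t.
  apply/eqP; rewrite eq_le (block_homo (ltW lt_xy)) /= leNgt; apply/negP => lt_st.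
  have [v' lt_vv'] : exists v', v < v'.
    case: v {lt_xy y_min} => [n|q]; first by exists (inl n.+1); rewrite omega_lt.
    by exists (inr (q + 1)%R); rewrite eta_lt; lra.
  have := y_min (s, v'); rewrite same_block_lt leNgt fst_lt // => /(_ lt_vv').
  by [].
move: lt_xy y_min; rewrite -st same_block_lt => {st t} lt_vw y_min.
have {}y_min u : v < u -> w <= u.
  by move=> lt_vu; rewrite leNgt -(same_block_lt s) -leNgt y_min ?same_block_lt.
case: v lt_vw y_min => [n|q] lt_vw y_min.
  exists n => //; congr pair; apply/le_anti; rewrite y_min ?omega_lt //=.
  case: w lt_vw {y_min} => [m|//]; rewrite omega_lt => lt_nm.
  by rewrite leNgt omega_lt -leqNgt.
case: w lt_vw y_min => [m|r]; first by rewrite ltNge ltW ?omega_lt_eta.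
rewrite eta_lt => lt_qr /(_ (inr ((q + r) / 2)%R)).
by rewrite leNgt !eta_lt => /(_ _)/negP[]; lra.
Qed.

(** A strict upper bound of a copy of [omega] lies above some point of the copy
    of [eta] that follows it. *)
Lemma eta_below (s : S) z : (forall n, ((s, inl n) : blocks) < z) ->
  exists q, ((s, inr q) : blocks) < z.
Proof.
case: z => t w z_ub.
have := block_homo (ltW (z_ub 0%N)); rewrite le_eqVlt => /predU1P[/= st|lt_st].
  move: z_ub; rewrite -st; case: w => [m /(_ m)|q _]; first by rewrite ltxx.
  by exists (q - 1)%R; rewrite same_block_lt eta_lt; lra.
by exists 0%R; exact: fst_lt.
Qed.

(** The points of the copies of [omega]. *)
Definition omegas : set blocks := [set x | in_omega x.2].

(** The [n]-th point of the copy of [omega] at [s]. *)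
Definition omega_pt (s : S) (n : nat) : subset_order omegas :=
  exist _ ((s, inl n) : blocks) (mem_set isT).

Lemma omega_ptE (x : subset_order omegas) : exists n, x = omega_pt (val x).1 n.
Proof.
case: x => [[s [n|q]] x_in]; first by exists n; apply: val_inj.
by have := set_mem x_in.
Qed.

Lemma omega_pt_lt s m n : (omega_pt s m < omega_pt s n) = (m < n)%N.
Proof. by rewrite -omega_lt -(same_block_lt s). Qed.

(** A convex set of points of the copies of [omega] that embeds into the blocks
    with convex image is contained in a single copy of [omega]. *)
Lemma omega_piece (f : subset_order omegas -> blocks)
    (I : set (subset_order omegas)) :
  {mono f : u v / u <= v} -> order_convex I -> order_convex (f @` I) ->
  forall u v, I u -> I v -> (val u).1 = (val v).1.
Proof.
move=> f_mono I_conv fI_conv.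
suff no_lt (x y : subset_order omegas) : I x -> I y -> ~ (val x).1 < (val y).1.
  move=> x y Ix Iy; case: (ltgtP (val x).1 (val y).1) => //.
    by move/no_lt => /(_ Ix Iy).
  by move/no_lt => /(_ Iy Ix).
have f_lt := leW_mono f_mono.
have [n0 ->] := omega_ptE x; move: (val x).1 => s {x} Ix Iy /= lt_sy.
(* Below y every point of I has a successor in I, preserved by f because the
   image of I is convex. *)
have succ_f t n : omega_pt s n0 <= omega_pt t n -> omega_pt t n < y ->
    is_succ (f (omega_pt t n)) (f (omega_pt t n.+1)).
  move=> le_sn lt_ny; have lt_nS : omega_pt t n < omega_pt t n.+1.
    by rewrite omega_pt_lt.
  have le_Sy : omega_pt t n.+1 <= y.
    have [m ym] := omega_ptE y; move: lt_ny; rewrite {}ym.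
    move: (val y).1 => t' lt_ny.
    have := block_homo (ltW (lt_ny : ((t, inl n) : blocks) < (t', inl m))).
    rewrite le_eqVlt /= => /predU1P[tt'|lt_tt'].
      by move: lt_ny; rewrite -tt' leNgt !omega_pt_lt -leqNgt.
    by apply: ltW; exact: (@fst_lt (t, inl n.+1) (t', inl m)).
  split=> [|z lt_z]; first by rewrite f_lt.
  rewrite leNgt; apply/negP => lt_zS.
  have [||||v Iv fv] := fI_conv (f (omega_pt t n)) z (f (omega_pt t n.+1)).
  - by exists (omega_pt t n) => //; apply: I_conv Ix Iy _ _ => //; exact: ltW.
  - exists (omega_pt t n.+1) => //; apply: I_conv Ix Iy _ _ => //.
    exact: le_trans (ltW lt_nS).
  - exact: ltW.
  - exact: ltW.
  move: lt_z lt_zS; rewrite -fv !f_lt.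
  have [m ->] := omega_ptE v => lt_nv lt_vS.
  have tv : t = (val v).1.
    apply/le_anti/andP; split.
      exact: (@block_homo (t, inl n) ((val v).1, inl m) (ltW lt_nv)).
    exact: (@block_homo ((val v).1, inl m) (t, inl n.+1) (ltW lt_vS)).
  move: lt_nv lt_vS; rewrite -tv !omega_pt_lt ltnS => lt_nm.
  by rewrite leqNgt lt_nm.
(* The points of the copy of s from x on go to consecutive points of one copy
   of omega, which thus lies entirely below f y. *)
have lt_y n : omega_pt s n < y by exact: (@fst_lt (s, inl n) (val y)).
have [m0 fx _] := succ_in_omega (succ_f _ _ (lexx _) (lt_y n0)).
have f_block k : f (omega_pt s (n0 + k)) = ((f (omega_pt s n0)).1, inl (m0 + k)%N).
  elim: k => [|k IHk]; first by rewrite !addn0.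
  have [|m] := succ_in_omega (succ_f s (n0 + k)%N _ (lt_y _)).
    by rewrite leNgt omega_pt_lt -leqNgt leq_addr.
  by rewrite IHk !addnS => -[->] ->.
have [n|q lt_qy] := @eta_below (f (omega_pt s n0)).1 (f y).
  apply: (@le_lt_trans _ _ (f (omega_pt s (n0 + n)))); last by rewrite f_lt.
  by rewrite f_block leNgt same_block_lt omega_lt -leqNgt leq_addl.
(* This point of eta is then in the image of I and below f y, so it should have
   an immediate successor. *)
have lt_xq : f (omega_pt s n0) < ((f (omega_pt s n0)).1, inr q).
  by rewrite {1}fx same_block_lt omega_lt_eta.
have [||v Iv fv] := fI_conv _ _ _ _ _ (ltW lt_xq) (ltW lt_qy).
- by exists (omega_pt s n0).
- by exists y.
move: lt_qy (ltW lt_xq); rewrite -fv f_lt f_mono.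
have [n vn] := omega_ptE v; rewrite vn => lt_vy le_xv.
by have [m] := succ_in_omega (succ_f _ _ le_xv lt_vy); rewrite -vn fv.
Qed.

End Blocks.

(** * Transitivity gives closure under convex sums *)

Section SumFromTransitivity.
Variables (C : set linCode) (K K' : linCode) (F : K -> set K').
Hypotheses (C_down : downward_closed C) (CK : C K) (CK' : C K').
Hypotheses (K_inh : inhabited K) (F_neq0 : forall k, F k !=set0).
Hypothesis F_le : forall k0 k1, k0 < k1 -> set_le (F k0) (F k1).

Let S := convex_sum F.

(** [s] is not the last point of the sum with its coordinate in [K']. *)
Definition separated (s : S) : Prop :=
  exists2 t, s < t & sum_val t = sum_val s.

(** The order lying between [omegas S] and [blocks S]: a copy of [eta] is kept
    only after the points of the sum whose [K']-coordinate occurs again. *)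
Definition partial_blocks : set (blocks S) :=
  [set x | in_omega x.2 \/ separated x.1].

Lemma sum_point : inhabited S.
Proof.
have [k] := K_inh; have [k' Fkk'] := F_neq0 k.
by have [s _ _] := convex_sum_point Fkk'; exists.
Qed.

Lemma omegas_inhabited : inhabited (subset_order (@omegas _ S)).
Proof. by have [s] := sum_point; exists; exact: omega_pt s 0. Qed.

Lemma conv_embeds_omegas :
  conv_embeds C (subset_order (@omegas _ S)) (subset_order partial_blocks).
Proof.
have in_pb (x : subset_order (@omegas _ S)) : val x \in partial_blocks.
  by rewrite inE; left; exact: set_mem (valP x).
pose f x : subset_order partial_blocks := exist _ (val x) (in_pb x).
apply: (@conv_embedsI C _ _ _ K _ _
  (fun x : subset_order (@omegas _ S) => tag (val x).1) f) => //.
- exact: mem_class_self.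
- exact: omegas_inhabited.
- by move=> x y le_xy; apply: tag_homo; exact: block_homo le_xy.
move=> k _ y _ [x /= xk <-] [z /= zk <-] le_xy le_yz.
have y1k : tag (val y).1 = k.
  apply/le_anti; rewrite -{1}zk -xk.
  by rewrite (tag_homo (block_homo le_xy)) (tag_homo (block_homo le_yz)).
have [y_om|y_eta] := boolP (in_omega (val y).2).
  by exists (exist _ (val y) (mem_set y_om)) => //; exact: val_inj.
have [y_om|[t lt_yt t_val]] := set_mem (valP y); first by rewrite y_om in y_eta.
(* y and z lie over the same point of S: as t has the K'-coordinate of y, its
   K-coordinate is larger than the one common to y and z, so z lies between y
   and t and has the K'-coordinate of y as well. *)
suff yz1 : (val y).1 = (val z).1.
  have z_om := set_mem (valP z).
  by rewrite (in_omega_le le_yz yz1 z_om) in y_eta.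
apply: convex_sum_inj; first by rewrite zk.
have le_yz1 := block_homo le_yz.
apply/le_anti; rewrite sum_val_homo //= -t_val sum_val_homo //.
rewrite leNgt; apply/negP => lt_tz.
have yt : (val y).1 = t.
  apply: convex_sum_inj => //; apply/le_anti; rewrite tag_homo ?(ltW lt_yt) //=.
  by rewrite y1k -zk tag_homo // ltW.
by rewrite yt ltxx in lt_yt.
Qed.

Lemma conv_embeds_partial_blocks :
  conv_embeds C (subset_order partial_blocks) (blocks S).
Proof.
apply: (@conv_embedsI C _ _ _ K' _ _
  (fun x : subset_order partial_blocks => sum_val (val x).1) val) => //.
- exact: mem_class_self.
- have [s] := sum_point; exists.
  by exact: exist _ ((s, inl 0%N) : blocks S) (mem_set (or_introl isT)).
- by move=> x y le_xy; apply: sum_val_homo => //; exact: block_homo le_xy.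
move=> k' _ y _ [x /= xk <-] [z /= zk <-] le_xy le_yz.
have yk : sum_val y.1 = k'.
  apply/le_anti; rewrite -{1}zk -xk.
  by rewrite (sum_val_homo F_le (block_homo le_xy))
             (sum_val_homo F_le (block_homo le_yz)).
suff y_in : partial_blocks y by exists (exist _ y (mem_set y_in)).
have [y_om|y_eta] := boolP (in_omega y.2); first by left.
right; have := block_homo le_yz; rewrite le_eqVlt => /predU1P[yz1|lt_yz1].
  rewrite yz1; have [z_om|//] := set_mem (valP z).
  by rewrite (in_omega_le le_yz yz1 z_om) in y_eta.
by exists (val z).1 => //; rewrite zk yk.
Qed.

(** If the outer two orders are related by pieces indexed by [K0], then each
    piece lies inside one copy of [omega], so sending [s] to the index of the
    piece containing the least point of its copy embeds the sum into [K0]. *)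
Lemma mem_class_sum :
  conv_embeds C (subset_order (@omegas _ S)) (blocks S) -> mem_class C S.
Proof.
move=> /conv_embedsP[K0 [p [f [CK0 p_homo p_surj f_mono f_conv]]]].
apply: mem_class_embeds CK0 sum_point _ => //.
exists (fun s => p (omega_pt s 0)); apply: le_mono => s t lt_st.
have le_p : p (omega_pt s 0) <= p (omega_pt t 0).
  by apply/p_homo/ltW; exact: (@fst_lt _ _ (s, inl 0%N) (t, inl 0%N)).
rewrite lt_neqAle le_p andbT; apply/eqP => p_st.
have fibre_conv : order_convex [set x | p x = p (omega_pt t 0)].
  move=> x y z /= xk zk le_xy le_yz; apply/le_anti.
  by rewrite -{1}zk -xk !p_homo.
have /= st := omega_piece f_mono fibre_conv (f_conv _) p_st erefl.
by rewrite st ltxx in lt_st.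
Qed.

Lemma blocks_countable : exists j : blocks S -> nat, injective j.
Proof.
pose j (x : blocks S) : nat * nat * omega_eta :=
  (val (tag x.1), val (sum_val x.1), x.2).
exists (fun x => pickle (j x)) => -[s w] [t v] /(pcan_inj pickleK).
move=> [tag_st val_st ->]; congr pair.
by apply: convex_sum_inj; apply: val_inj.
Qed.

(** The three orders are countably infinite, hence isomorphic to codes in [LO],
    to which transitivity applies. *)
Lemma LO_trans_sum : Transitive (@conv_embeds_LO C) -> mem_class C S.
Proof.
move=> LO_trans; have [s] := sum_point; have [j j_inj] := blocks_countable.
have omega_inj : injective (omega_pt s) by move=> m n /(congr1 val) [].
have [r r_LO r_iso] : exists2 r, LO r &
    order_isomorphic r (subset_order (@omegas _ S)).
  by apply: infinite_code (inj_comp j_inj val_inj) (infinite_inj omega_inj).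
have [r' r'_LO r'_iso] : exists2 r, LO r &
    order_isomorphic r (subset_order partial_blocks).
  apply: infinite_code (inj_comp j_inj val_inj) _.
  pose g n : subset_order partial_blocks :=
    exist _ ((s, inl n) : blocks S) (mem_set (or_introl isT)).
  by apply: (@infinite_inj _ g) => m n /(congr1 val) [].
have [r'' r''_LO r''_iso] : exists2 r, LO r & order_isomorphic r (blocks S).
  apply: infinite_code j_inj _.
  by apply: (@infinite_inj _ (fun n => (s, inl n) : blocks S)) => m n [].
apply: mem_class_sum.
apply: (conv_embeds_iso (order_isomorphic_sym r_iso) r''_iso).
have rr' : conv_embeds C r r'.
  apply: conv_embeds_iso r_iso (order_isomorphic_sym r'_iso) _.
  exact: conv_embeds_omegas.
have r'r'' : conv_embeds C r' r''.
  apply: conv_embeds_iso r'_iso (order_isomorphic_sym r''_iso) _.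
  exact: conv_embeds_partial_blocks.
exact: (LO_trans (exist _ r (mem_set r_LO)) (exist _ r' (mem_set r'_LO))
                 (exist _ r'' (mem_set r''_LO)) rr' r'r'').
Qed.

End SumFromTransitivity.

(** * The equivalence *)

Theorem theorem3p9 (C : set linCode)
  (C_Lin : C `<=` Lin) (C_nonempty : C !=set0) (C_down : downward_closed C) :
  [<-> ccs C;
       Transitive (conv_embeds_all C);
       Transitive (conv_embeds_LO C)].
Proof.
tfae.
- move=> C_ccs L L' L''; apply: ccs_conv_embeds_trans => //.
  exact: lin_inhabited.
- move=> all_trans [r r_LO] [r' r'_LO] [r'' r''_LO].
  have inh (s : linCode) : s \in LO -> inhabited s.
    by move=> /set_mem s_LO; apply: code_sort_inhabited; right.
  exact: (@all_trans (LinOrder (inh _ r_LO)) (LinOrder (inh _ r'_LO))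
                     (LinOrder (inh _ r''_LO))).
move=> LO_trans K K' F CK CK' F_neq0 _ F_le.
have K_inh := code_sort_inhabited (C_Lin _ CK).
exact: LO_trans_sum.
Qed.
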